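(* Let $(H,I)$ be a Dorroh pair of bialgebras. Assume that $H$ is a Hopf algebra with antipode $S_H$. Then $H\ltimes_d I$ is a Hopf algebra Dorroh extension of $H$ by $I$ (where $H$ and $I$ are identified with the subspaces $\{(h,0)\mid h\in H\}$ and $\{(0,x)\mid x\in I\}$ of $H\ltimes_d I$) if and only if there exists a linear endomorphism $S_I$ of $I$ such that for any $x\in I$, $$\sum S_H(x_{(-1)})x_{(0)}+\sum S_I(x_{(0)})x_{(1)}+\sum S_I(x_1)x_2=0,$$ $$\sum x_{(-1)}S_I(x_{(0)})+\sum x_{(0)}S_H(x_{(1)})+\sum x_1S_I(x_2)=0.$$
   Context: Everything is over a field $k$, $\otimes=\otimes_k$. Algebras are associative but not necessarily unital; coalgebras are coassociative but not necessarily counital. If an algebra is unital, its modules are assumed unital; if a coalgebra is counital, its comodules are assumed counital. Write $\Delta(c)=\sum c_1\otimes c_2$, and $\rho_l(x)=\sum x_{(-1)}\otimes x_{(0)}$, $\rho_r(x)=\sum x_{(0)}\otimes x_{(1)}$ for left and right comodule structure maps. A bialgebra is a vector space that is both an algebra and a coalgebra with multiplicative comultiplication $\Delta(ab)=\Delta(a)\Delta(b)$ (no identity or counit required). A Hopf algebra is a usual one: unital, counital, with antipode. $(H,I)$ is a Dorroh pair of algebras if $H$ and $I$ are algebras, $I$ is an $H$-bimodule, and $a(xy)=(ax)y$, $(xa)y=x(ay)$, $(xy)a=x(ya)$ for all $a\in H$, $x,y\in I$. Then $H\ltimes_d I=H\oplus I$ is an algebra with $(a,x)(b,y)=(ab,\,ay+xb+xy)$.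 $(H,I)$ is a Dorroh pair of coalgebras if $H$ and $I$ are coalgebras, $I$ is an $H$-bicomodule, and for all $x\in I$: $\sum x_1\otimes x_{2(0)}\otimes x_{2(1)}=\sum x_{(0)1}\otimes x_{(0)2}\otimes x_{(1)}$, $\sum x_{1(-1)}\otimes x_{1(0)}\otimes x_2=\sum x_{(-1)}\otimes x_{(0)1}\otimes x_{(0)2}$, $\sum x_{1(0)}\otimes x_{1(1)}\otimes x_2=\sum x_1\otimes x_{2(-1)}\otimes x_{2(0)}$. Then $H\ltimes_d I=H\oplus I$ is a coalgebra with $\Delta(h,x)=\sum (h_1,0)\otimes (h_2,0)+\sum (x_{(-1)},0)\otimes (0,x_{(0)})+\sum (0,x_{(0)})\otimes (x_{(1)},0)+\sum (0,x_1)\otimes (0,x_2)$. $(H,I)$ is a Dorroh pair of bialgebras if it is both a Dorroh pair of algebras and a Dorroh pair of coalgebras and $H\ltimes_d I$ with these structures is a bialgebra (then $H$ is a bialgebra). If moreover $H$ is a Hopf algebra, $H\ltimes_d I$ has identity $(1_H,0)$ and counit $(h,x)\mapsto \varepsilon_H(h)$. For a Hopf algebra $H$, a Hopf algebra $A$ is a Hopf algebra Dorroh extension of $H$ by $I$ if $H$ is a Hopf subalgebra of $A$, $I$ is a Hopf ideal of $A$ (two-sided ideal, $\Delta(I)\subseteq I\otimes A+A\otimes I$, $\varepsilon(I)=0$, $S(I)\subseteq I$), and $A=H\oplus I$ as vector spaces. *)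

(* Defs.v *)
From HB Require Import structures.
From mathcomp Require Import all_boot all_algebra.
From mathcomp Require Import boolp classical_sets.

Set Implicit Arguments.
Unset Strict Implicit.
Unset Printing Implicit Defensive.

Import GRing.Theory.
Local Open Scope ring_scope.

Definition bilinear_map (k : fieldType) (U V W : lmodType k) (f : U -> V -> W) :
    Prop :=
  (forall u, linear (f u)) /\ (forall v, linear (f^~ v)).

(** MathComp has no tensor product of arbitrary (possibly infinite-dimensional)
    vector spaces.  [tensor U V] below is the usual quotient: the free commutative
    monoid on U * V, whose elements are finite sequences of pairs standing for
    sums of pure tensors, modulo the congruence generated by bilinearity. *)
Inductive tensor_rel (k : fieldType) (U V : lmodType k) :
    seq (U * V) -> seq (U * V) -> Prop :=
  | tr_refl s : tensor_rel s s
  | tr_sym s t : tensor_rel s t -> tensor_rel t s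
  | tr_trans s t r : tensor_rel s t -> tensor_rel t r -> tensor_rel s r
  | tr_cat s s' t t' :
      tensor_rel s s' -> tensor_rel t t' -> tensor_rel (s ++ t) (s' ++ t')
  | tr_catC s t : tensor_rel (s ++ t) (t ++ s)
  | tr_0 v : tensor_rel [:: (0, v)] [::]
  | tr_addl u u' v : tensor_rel [:: (u + u', v)] [:: (u, v); (u', v)]
  | tr_addr u v v' : tensor_rel [:: (u, v + v')] [:: (u, v); (u, v')]
  | tr_scale (a : k) u v : tensor_rel [:: (a *: u, v)] [:: (u, a *: v)].

Section Tensor.
Context {k : fieldType}.
Variables U V : lmodType k.

Definition tensor_eqv (s t : seq (U * V)) : bool := `[< tensor_rel s t >].

Lemma tensor_eqv_refl : reflexive tensor_eqv.
Proof. by move=> s; apply/asboolP/tr_refl. Qed.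
Lemma tensor_eqv_sym : symmetric tensor_eqv.
Proof. by move=> s t; apply/asboolP/asboolP; apply: tr_sym. Qed.
Lemma tensor_eqv_trans : transitive tensor_eqv.
Proof.
by move=> t s r /asboolP st /asboolP tr; apply/asboolP; apply: tr_trans tr.
Qed.
Canonical tensor_eqv_equiv :=
  EquivRel tensor_eqv tensor_eqv_refl tensor_eqv_sym tensor_eqv_trans.

Definition tensor := {eq_quot tensor_eqv}%qT.
HB.instance Definition _ : Choice tensor := Choice.on tensor.
HB.instance Definition _ : EqQuotient _ tensor_eqv tensor := EqQuotient.on tensor.

Definition tclass (s : seq (U * V)) : tensor := (\pi_tensor s)%qT.

Lemma tclass_eq s t : tensor_rel s t -> tclass s = tclass t.
Proof. by move=> st; apply/eqmodP/asboolP. Qed.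
Lemma tclassP s t : tclass s = tclass t -> tensor_rel s t.
Proof. by move=> /eqmodP/asboolP. Qed.
Lemma tclassK (t : tensor) : tclass (repr t) = t.
Proof. exact: reprK. Qed.
Lemma repr_tclass s : tensor_rel (repr (tclass s)) s.
Proof. by apply: tclassP; rewrite tclassK. Qed.

Definition tensor_zero : tensor := tclass [::].
Definition tensor_add (s t : tensor) : tensor := tclass (repr s ++ repr t).
Definition tensor_scale (a : k) (t : tensor) : tensor :=
  tclass [seq (a *: p.1, p.2) | p <- repr t].
Definition tensor_opp (t : tensor) : tensor := tensor_scale (-1) t.

Lemma tensor_addE s t : tensor_add (tclass s) (tclass t) = tclass (s ++ t).
Proof. by apply: tclass_eq; apply: tr_cat; apply: repr_tclass. Qed.

Lemma tr_map_scale (a : k) (s t : seq (U * V)) : tensor_rel s t ->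
  tensor_rel [seq (a *: p.1, p.2) | p <- s] [seq (a *: p.1, p.2) | p <- t].
Proof.
elim=> {s t}.
- by move=> s; apply: tr_refl.
- by move=> s t _; apply: tr_sym.
- by move=> s t r _ st _; apply: tr_trans.
- by move=> s s' t t' _ ss' _ tt'; rewrite !map_cat; apply: tr_cat.
- by move=> s t; rewrite !map_cat; apply: tr_catC.
- by move=> v /=; rewrite scaler0; apply: tr_0.
- by move=> u u' v /=; rewrite scalerDr; apply: tr_addl.
- by move=> u v v' /=; apply: tr_addr.
- move=> b u v /=; rewrite scalerA mulrC -scalerA; exact: tr_scale.
Qed.

Lemma tensor_scaleE a s :
  tensor_scale a (tclass s) = tclass [seq (a *: p.1, p.2) | p <- s].
Proof. by apply: tclass_eq; apply: tr_map_scale; apply: repr_tclass. Qed.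

Lemma tensor_ind (P : tensor -> Prop) : (forall s, P (tclass s)) -> forall t, P t.
Proof. by move=> Ps t; rewrite -(tclassK t). Qed.

Lemma tensor_addA : associative tensor_add.
Proof.
elim/tensor_ind => s; elim/tensor_ind => t; elim/tensor_ind => r.
by rewrite !tensor_addE catA.
Qed.
Lemma tensor_addC : commutative tensor_add.
Proof.
elim/tensor_ind => s; elim/tensor_ind => t.
by rewrite !tensor_addE; apply: tclass_eq; apply: tr_catC.
Qed.
Lemma tensor_add0 : left_id tensor_zero tensor_add.
Proof. by elim/tensor_ind => s; rewrite tensor_addE. Qed.

Lemma tr_map_scaleD (a b : k) s :
  tensor_rel [seq ((a + b) *: p.1, p.2) | p <- s]
    ([seq (a *: p.1, p.2) | p <- s] ++ [seq (b *: p.1, p.2) | p <- s] :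
       seq (U * V)).
Proof.
elim: s => [|[u v] s IHs] /=; first exact: tr_refl.
rewrite scalerDl.
apply: tr_trans (tr_cat (tr_addl (a *: u) (b *: u) v) IHs) _.
have := tr_cat (tr_refl [:: (a *: u, v)])
  (tr_cat (tr_catC [:: (b *: u, v)] [seq (a *: p.1, p.2) | p <- s])
          (tr_refl [seq (b *: p.1, p.2) | p <- s])).
by rewrite -!catA.
Qed.

Lemma tr_map_scale0 (s : seq (U * V)) :
  tensor_rel [seq (0 *: p.1, p.2) | p <- s] [::].
Proof.
elim: s => [|[u v] s IHs] /=; first exact: tr_refl.
by rewrite scale0r; exact: tr_cat (tr_0 _ v) IHs.
Qed.

Lemma tensor_scale1 : left_id 1 tensor_scale.
Proof.
elim/tensor_ind => s; rewrite tensor_scaleE; congr tclass.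
by elim: s => [|[u v] s /= ->] //=; rewrite scale1r.
Qed.
Lemma tensor_scaleA a b t :
  tensor_scale a (tensor_scale b t) = tensor_scale (a * b) t.
Proof.
elim/tensor_ind: t => s; rewrite !tensor_scaleE -map_comp; congr tclass.
by apply: eq_map => p /=; rewrite scalerA.
Qed.
Lemma tensor_scaleDr : right_distributive tensor_scale tensor_add.
Proof.
move=> a; elim/tensor_ind => s; elim/tensor_ind => t.
by rewrite !(tensor_addE, tensor_scaleE) map_cat.
Qed.
Lemma tensor_scaleDl t a b :
  tensor_scale (a + b) t = tensor_add (tensor_scale a t) (tensor_scale b t).
Proof.
elim/tensor_ind: t => s; rewrite !tensor_scaleE tensor_addE.
exact/tclass_eq/tr_map_scaleD.
Qed.
Lemma tensor_addN : left_inverse tensor_zero tensor_opp tensor_add.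
Proof.
move=> t; rewrite /tensor_opp -{2}[t]tensor_scale1 -tensor_scaleDl addNr.
elim/tensor_ind: t => s; rewrite tensor_scaleE.
exact/tclass_eq/tr_map_scale0.
Qed.

HB.instance Definition _ := GRing.isZmodule.Build tensor
  tensor_addA tensor_addC tensor_add0 tensor_addN.
HB.instance Definition _ := GRing.Zmodule_isLmodule.Build k tensor
  tensor_scaleA tensor_scale1 tensor_scaleDr tensor_scaleDl.

Definition tens (u : U) (v : V) : tensor := tclass [:: (u, v)].

End Tensor.

Notation "u \ox v" := (tens u v) (at level 40, left associativity) : ring_scope.

(** [\tsum_(u, v <- t) F] is Sweedler's [sum F(u, v)] for [t = sum u (x) v].  It
    is computed on a chosen representative of [t]; [tsum_tens] and [tsum_linear]
    show that it is the linear map induced by [F] whenever [F] is bilinear. *)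
Definition tsum (k : fieldType) (U V W : lmodType k) (t : tensor U V)
    (F : U -> V -> W) : W :=
  \sum_(p <- repr t) F p.1 p.2.

Notation "\tsum_ ( u , v <- t ) F" := (tsum t (fun u v => F))
  (at level 41, F at level 41, u name, v name,
   format "'[' \tsum_ ( u ,  v  <-  t ) '/  '  F ']'") : ring_scope.

Section TensorTheory.
Context {k : fieldType} {U V W : lmodType k}.

Lemma tens_bilinear : bilinear_map (@tens k U V).
Proof.
split=> [u a v v'|v a u u'].
  rewrite /tens /= (tclass_eq (tr_addr _ _ _)).
  rewrite -[a *: tclass _]/(tensor_scale a _) tensor_scaleE /= -[RHS]/(tensor_add _ _).
  rewrite tensor_addE /=; apply: tclass_eq.
  by apply: (@tr_cat _ _ _ [:: _] [:: _]) (tr_refl _); apply/tr_sym/tr_scale.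
rewrite /tens /= (tclass_eq (tr_addl _ _ _)).
rewrite -[a *: tclass _]/(tensor_scale a _) tensor_scaleE /= -[RHS]/(tensor_add _ _).
by rewrite tensor_addE.
Qed.

Lemma tensorE (t : tensor U V) : t = \sum_(p <- repr t) p.1 \ox p.2.
Proof.
rewrite -{1}[t]tclassK; elim: (repr t) => [|[u v] s IHs]; first by rewrite big_nil.
by rewrite big_cons -IHs /= -[RHS]/(tensor_add _ _) tensor_addE.
Qed.

Variable F : U -> V -> W.
Hypothesis FB : bilinear_map F.

Let FDl v u u' : F (u + u') v = F u v + F u' v.
Proof. by have := FB.2 v 1 u u'; rewrite !scale1r. Qed.
Let FDr u v v' : F u (v + v') = F u v + F u v'.
Proof. by have := FB.1 u 1 v v'; rewrite !scale1r. Qed.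
Let F0l v : F 0 v = 0.
Proof. by apply: (addrI (F 0 v)); rewrite -FDl !addr0. Qed.
Let F0r u : F u 0 = 0.
Proof. by apply: (addrI (F u 0)); rewrite -FDr !addr0. Qed.
Let FZl a u v : F (a *: u) v = a *: F u v.
Proof. by have := FB.2 v a u 0; rewrite !addr0 F0l addr0. Qed.
Let FZr a u v : F u (a *: v) = a *: F u v.
Proof. by have := FB.1 u a v 0; rewrite !addr0 F0r addr0. Qed.

Lemma tensor_rel_sum s t : tensor_rel s t ->
  \sum_(p <- s) F p.1 p.2 = \sum_(p <- t) F p.1 p.2.
Proof.
elim=> {s t} //.
- by move=> s t r _ -> _ ->.
- by move=> s s' t t' _ ss' _ tt'; rewrite !big_cat /= ss' tt'.
- by move=> s t; rewrite !big_cat /= addrC.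
- by move=> v; rewrite big_seq1 big_nil F0l.
- by move=> u u' v; rewrite !big_cons !big_nil /= !addr0 FDl.
- by move=> u v v'; rewrite !big_cons !big_nil /= !addr0 FDr.
- by move=> a u v; rewrite !big_seq1 /= FZl FZr.
Qed.

Lemma tsum_class s : tsum (tclass s) F = \sum_(p <- s) F p.1 p.2.
Proof. exact: tensor_rel_sum (repr_tclass s). Qed.

Lemma tsum_tens u v : tsum (u \ox v) F = F u v.
Proof. by rewrite tsum_class big_seq1. Qed.

Lemma tsum_linear : linear (fun t : tensor U V => tsum t F).
Proof.
move=> a s t; rewrite -(tclassK s) -(tclassK t).
move: (repr s) (repr t) => {}s {}t.
rewrite -[a *: tclass _]/(tensor_scale a _) tensor_scaleE -[X in tsum X]/(tensor_add _ _).
rewrite tensor_addE !tsum_class big_cat /= big_map; congr (_ + _).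
by rewrite scaler_sumr; apply: eq_bigr => p _; rewrite FZl.
Qed.

End TensorTheory.

Definition tensor_of_sets (k : fieldType) (A : lmodType k) (P Q : set A) :
    set (tensor A A) :=
  [set t | exists2 s : seq (A * A), (forall p, p \in s -> P p.1 /\ Q p.2) &
           t = \sum_(p <- s) p.1 \ox p.2].

(** Algebras need not be unital and coalgebras need not be counital.
    Iterated tensors are all taken in the form [U (x) (V (x) W)], which makes the
    associativity isomorphism implicit. *)

Section Structures.
Context {k : fieldType}.
Implicit Types U V A C M : lmodType k.

Record is_algebra A (m : A -> A -> A) : Prop := {
  algebra_bilinear : bilinear_map m;
  algebra_assoc : associative m }.

Definition is_identity A (m : A -> A -> A) (e : A) : Prop :=
  left_id e m /\ right_id e m.

Record is_coalgebra C (D : C -> tensor C C) : Prop := {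
  coalgebra_linear : linear D;
  coalgebra_coassoc : forall c,
    \tsum_(c1, c2 <- D c) \tsum_(c11, c12 <- D c1) c11 \ox (c12 \ox c2)
    = \tsum_(c1, c2 <- D c) c1 \ox D c2 }.

Definition is_counit C (D : C -> tensor C C) (eps : {scalar C}) : Prop :=
  forall c, \tsum_(c1, c2 <- D c) eps c1 *: c2 = c /\
            \tsum_(c1, c2 <- D c) eps c2 *: c1 = c.

Definition tensor_mul A (m : A -> A -> A) (s t : tensor A A) : tensor A A :=
  \tsum_(a1, a2 <- s) \tsum_(b1, b2 <- t) m a1 b1 \ox m a2 b2.

Record is_bialgebra A (m : A -> A -> A) (D : A -> tensor A A) : Prop := {
  bialgebra_algebra : is_algebra m;
  bialgebra_coalgebra : is_coalgebra D;
  bialgebra_mul : forall a b, D (m a b) = tensor_mul m (D a) (D b) }.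

(* Bimodules over a unital algebra are unital, and bicomodules over a counital
   coalgebra are counital; an identity and a counit are unique when they exist. *)
Record is_bimodule A M (m : A -> A -> A) (l : A -> M -> M) (r : M -> A -> M) :
    Prop := {
  bimodule_lbilinear : bilinear_map l;
  bimodule_rbilinear : bilinear_map r;
  bimodule_lassoc : forall a b x, l (m a b) x = l a (l b x);
  bimodule_rassoc : forall a b x, r x (m a b) = r (r x a) b;
  bimodule_lr : forall a b x, r (l a x) b = l a (r x b);
  bimodule_unital : forall e, is_identity m e -> forall x, l e x = x /\ r x e = x }.

Record is_bicomodule C M (D : C -> tensor C C) (rl : M -> tensor C M)
    (rr : M -> tensor M C) : Prop := {
  bicomodule_llinear : linear rl;
  bicomodule_rlinear : linear rr;
  bicomodule_lcoassoc : forall x,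
    \tsum_(c, y <- rl x) \tsum_(c1, c2 <- D c) c1 \ox (c2 \ox y)
    = \tsum_(c, y <- rl x) c \ox rl y;
  bicomodule_rcoassoc : forall x,
    \tsum_(y, c <- rr x) \tsum_(z, d <- rr y) z \ox (d \ox c)
    = \tsum_(y, c <- rr x) y \ox D c;
  bicomodule_lr : forall x,
    \tsum_(y, c <- rr x) \tsum_(d, z <- rl y) d \ox (z \ox c)
    = \tsum_(d, z <- rl x) d \ox rr z;
  bicomodule_counital : forall eps : {scalar C}, is_counit D eps ->
    forall x, \tsum_(c, y <- rl x) eps c *: y = x /\
              \tsum_(y, c <- rr x) eps c *: y = x }.

(* The unit, counit and antipode turning a given multiplication m and
   comultiplication D into a (unital, counital) Hopf algebra; they are unique when
   they exist. *)
Record hopf_algebra A (m : A -> A -> A) (D : A -> tensor A A) := HopfAlgebra {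
  one_of : A;
  counit_of : {scalar A};
  antipode_of : {linear A -> A};
  hopf_bialgebra : is_bialgebra m D;
  hopf_one : is_identity m one_of;
  hopf_counit : is_counit D counit_of;
  hopf_comul_one : D one_of = one_of \ox one_of;
  hopf_counit_one : counit_of one_of = 1;
  hopf_counit_mul : forall a b, counit_of (m a b) = counit_of a * counit_of b;
  hopf_antipode_l : forall a,
    \tsum_(a1, a2 <- D a) m (antipode_of a1) a2 = counit_of a *: one_of;
  hopf_antipode_r : forall a,
    \tsum_(a1, a2 <- D a) m a1 (antipode_of a2) = counit_of a *: one_of }.

Definition is_subspace A (P : set A) : Prop :=
  P 0 /\ forall (a : k) u v, P u -> P v -> P (a *: u + v).

Record is_hopf_subalgebra A m D (HA : @hopf_algebra A m D) (P : set A) : Prop := {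
  hsub_subspace : is_subspace P;
  hsub_mul : forall a b, P a -> P b -> P (m a b);
  hsub_one : P (one_of HA);
  hsub_comul : forall a, P a -> tensor_of_sets P P (D a);
  hsub_antipode : forall a, P a -> P (antipode_of HA a) }.

Record is_hopf_embedding H mH DH (HH : @hopf_algebra H mH DH)
    A mA DA (HA : @hopf_algebra A mA DA) (i : H -> A) : Prop := {
  hemb_linear : linear i;
  hemb_inj : injective i;
  hemb_mul : forall a b, i (mH a b) = mA (i a) (i b);
  hemb_one : i (one_of HH) = one_of HA;
  hemb_comul : forall a, DA (i a) = \tsum_(a1, a2 <- DH a) i a1 \ox i a2;
  hemb_counit : forall a, counit_of HA (i a) = counit_of HH a;
  hemb_antipode : forall a, antipode_of HA (i a) = i (antipode_of HH a) }.

Record is_hopf_ideal A m D (HA : @hopf_algebra A m D) (J : set A) : Prop := {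
  hideal_subspace : is_subspace J;
  hideal_mull : forall a x, J x -> J (m a x);
  hideal_mulr : forall a x, J x -> J (m x a);
  hideal_comul : forall x, J x ->
    exists t1 t2, [/\ tensor_of_sets J setT t1, tensor_of_sets setT J t2
                    & D x = t1 + t2];
  hideal_counit : forall x, J x -> counit_of HA x = 0;
  hideal_antipode : forall x, J x -> J (antipode_of HA x) }.

Definition is_direct_sum A (P Q : set A) : Prop :=
  (forall a, exists p q, [/\ P p, Q q & a = p + q]) /\
  (forall a, P a -> Q a -> a = 0).

(* The Hopf algebra H is identified with a Hopf subalgebra of A through i. *)
Record is_hopf_dorroh_extension H mH DH (HH : @hopf_algebra H mH DH)
    A mA DA (HA : @hopf_algebra A mA DA) (i : H -> A) (J : set A) : Prop := {
  hdext_embedding : is_hopf_embedding HH HA i;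
  hdext_subalgebra : is_hopf_subalgebra HA (range i);
  hdext_ideal : is_hopf_ideal HA J;
  hdext_sum : is_direct_sum (range i) J }.

(* Operations only; the axioms are in [is_dorroh_pair_of_bialgebras]. *)
Record dorroh_data (H I : lmodType k) := DorrohData {
  mulH : H -> H -> H;
  mulI : I -> I -> I;
  lact : H -> I -> I;
  ract : I -> H -> I;
  comulH : H -> tensor H H;
  comulI : I -> tensor I I;
  lcoact : I -> tensor H I;
  rcoact : I -> tensor I H }.

Section Dorroh.
Variables (H I : lmodType k) (P : dorroh_data H I).

Record is_dorroh_pair_of_algebras : Prop := {
  dpa_algebraH : is_algebra (mulH P);
  dpa_algebraI : is_algebra (mulI P);
  dpa_bimodule : is_bimodule (mulH P) (lact P) (ract P);
  dpa_lact_mul : forall a x y, lact P a (mulI P x y) = mulI P (lact P a x) y;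
  dpa_ract_lact : forall a x y, mulI P (ract P x a) y = mulI P x (lact P a y);
  dpa_ract_mul : forall a x y, ract P (mulI P x y) a = mulI P x (ract P y a) }.

Record is_dorroh_pair_of_coalgebras : Prop := {
  dpc_coalgebraH : is_coalgebra (comulH P);
  dpc_coalgebraI : is_coalgebra (comulI P);
  dpc_bicomodule : is_bicomodule (comulH P) (lcoact P) (rcoact P);
  dpc_rcoact_comul : forall x,
    \tsum_(x1, x2 <- comulI P x) x1 \ox rcoact P x2
    = \tsum_(y, h <- rcoact P x) \tsum_(y1, y2 <- comulI P y) y1 \ox (y2 \ox h);
  dpc_lcoact_comul : forall x,
    \tsum_(x1, x2 <- comulI P x) \tsum_(h, y <- lcoact P x1) h \ox (y \ox x2)
    = \tsum_(h, y <- lcoact P x) h \ox comulI P y;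
  dpc_rcoact_lcoact : forall x,
    \tsum_(x1, x2 <- comulI P x) \tsum_(y, h <- rcoact P x1) y \ox (h \ox x2)
    = \tsum_(x1, x2 <- comulI P x) x1 \ox lcoact P x2 }.

Definition dorroh_inl (h : H) : H * I := (h, 0).
Definition dorroh_inr (x : I) : H * I := (0, x).

Definition dorroh_mul (p q : H * I) : H * I :=
  (mulH P p.1 q.1, lact P p.1 q.2 + ract P p.2 q.1 + mulI P p.2 q.2).

Definition dorroh_comul (p : H * I) : tensor (H * I)%type (H * I)%type :=
  \tsum_(h1, h2 <- comulH P p.1) dorroh_inl h1 \ox dorroh_inl h2
  + \tsum_(h, x <- lcoact P p.2) dorroh_inl h \ox dorroh_inr x
  + \tsum_(x, h <- rcoact P p.2) dorroh_inr x \ox dorroh_inl h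
  + \tsum_(x1, x2 <- comulI P p.2) dorroh_inr x1 \ox dorroh_inr x2.

Record is_dorroh_pair_of_bialgebras : Prop := {
  dpb_algebras : is_dorroh_pair_of_algebras;
  dpb_coalgebras : is_dorroh_pair_of_coalgebras;
  dpb_bialgebra : is_bialgebra dorroh_mul dorroh_comul }.

End Dorroh.
End Structures.

(* Main.v *)
(** Since the comultiplication of [H ⋉ I] sends [(h, x)] to the sum of its four
    blocks in [H (x) H], [H (x) I], [I (x) H] and [I (x) I], convolving
    [(h, x) |-> (S_H h, S_I x)] with the identity gives [eps h *: 1] in the [H]
    component, and the left-hand sides of the two displayed equations in the [I]
    component. Conversely, the antipode of [H ⋉ I] extends [S_H] and preserves
    [I], so it has this shape. *)
From HB Require Import structures.
Require Import Defs.
From mathcomp Require Import all_boot all_algebra.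
From mathcomp Require Import boolp classical_sets.

Set Implicit Arguments.
Unset Strict Implicit.
Unset Printing Implicit Defensive.

Import GRing.Theory.
Local Open Scope ring_scope.

(** * Sums over tensors, and membership in tensor products of subsets *)

Section Linearity.
Context {k : fieldType}.
Implicit Types U V W : lmodType k.

Lemma linear_map0 U V (f : U -> V) : linear f -> f 0 = 0.
Proof.
by move=> fL; have := fL (-1) 0 0; rewrite scaler0 addr0 scaleN1r addNr.
Qed.

Lemma bilinear_map0l U V W (F : U -> V -> W) v : bilinear_map F -> F 0 v = 0.
Proof. by move=> FB; apply: linear_map0 (FB.2 v). Qed.

Lemma bilinear_map0r U V W (F : U -> V -> W) u : bilinear_map F -> F u 0 = 0.
Proof. by move=> FB; apply: linear_map0 (FB.1 u). Qed.

Lemma bilinear_map_comp U V W U' V' (F : U -> V -> W)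
    (f : {linear U' -> U}) (g : {linear V' -> V}) :
  bilinear_map F -> bilinear_map (fun u v => F (f u) (g v)).
Proof.
move=> FB; split=> [u a v v'|v a u u'] /=; rewrite linearP.
  exact: (FB.1).
exact: (FB.2).
Qed.

Lemma eq_tsum U V W (t : tensor U V) (F G : U -> V -> W) :
  (forall u v, F u v = G u v) -> tsum t F = tsum t G.
Proof. by move=> FG; apply: eq_bigr => p _. Qed.

Lemma tsum_eq0 U V W (t : tensor U V) (F : U -> V -> W) :
  (forall u v, F u v = 0) -> tsum t F = 0.
Proof. by move=> F0; apply: big1 => p _. Qed.

Lemma tsum0 U V W (F : U -> V -> W) : bilinear_map F -> tsum 0 F = 0.
Proof. by move=> FB; apply: linear_map0 (tsum_linear FB). Qed.

Lemma tsumD U V W (F : U -> V -> W) (s t : tensor U V) :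
  bilinear_map F -> tsum (s + t) F = tsum s F + tsum t F.
Proof. by move=> FB; have := tsum_linear FB 1 s t; rewrite !scale1r. Qed.

(** The representative chosen for the inner sum has no direct relation to those of its summands.
    Bilinearity of [F] makes [tsum _ F] additive, so it passes through the finite sum. *)
Lemma tsum_tsum U V U' V' W (F : U -> V -> W) (G : U' -> V' -> tensor U V)
    (t : tensor U' V') :
  bilinear_map F -> tsum (tsum t G) F = \tsum_(u, v <- t) tsum (G u v) F.
Proof.
move=> FB; apply: (big_morph (fun s => tsum s F)) => [s s'|]; first exact: tsumD.
exact: tsum0.
Qed.

Lemma linear_tsum U V W W' (f : {linear W -> W'}) (t : tensor U V)
    (F : U -> V -> W) : f (tsum t F) = \tsum_(u, v <- t) f (F u v).
Proof. exact: linear_sum. Qed.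

Lemma pair_ext U V (p q : U * V) : p.1 = q.1 -> p.2 = q.2 -> p = q.
Proof. by case: p q => [? ?] [? ?] /= -> ->. Qed.

Lemma tensor_of_setsD (A : lmodType k) (P Q : set A) s t :
  tensor_of_sets P Q s -> tensor_of_sets P Q t -> tensor_of_sets P Q (s + t).
Proof.
move=> [s' s'P ->] [t' t'P ->]; exists (s' ++ t'); last by rewrite big_cat.
by move=> p; rewrite mem_cat => /orP[/s'P|/t'P].
Qed.

Lemma tensor_of_sets_tsum (A : lmodType k) (P Q : set A) U V (t : tensor U V)
    (f : U -> A) (g : V -> A) :
  (forall u, P (f u)) -> (forall v, Q (g v)) ->
  tensor_of_sets P Q (\tsum_(u, v <- t) f u \ox g v).
Proof.
move=> fP gQ; exists [seq (f p.1, g p.2) | p <- repr t].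
  by move=> _ /mapP[p _ ->]; split; [apply: fP | apply: gQ].
by rewrite big_map.
Qed.

Lemma range_is_subspace U V (f : {linear U -> V}) : is_subspace (range f).
Proof.
split=> [|a _ _ [u _ <-] [v _ <-]]; first by exists 0; rewrite ?linear0.
by exists (a *: u + v); rewrite ?linearP.
Qed.

(** * The two inclusions and the block-diagonal map as linear maps *)

Lemma dorroh_inl_linear (H I : lmodType k) : linear (@dorroh_inl k H I).
Proof. by move=> a u v; apply: pair_ext; rewrite //= scaler0 addr0. Qed.

Lemma dorroh_inr_linear (H I : lmodType k) : linear (@dorroh_inr k H I).
Proof. by move=> a u v; apply: pair_ext; rewrite //= scaler0 addr0. Qed.

HB.instance Definition _ (H I : lmodType k) :=
  GRing.isLinear.Build k H (H * I)%type _ (@dorroh_inl k H I)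
    (@dorroh_inl_linear H I).
HB.instance Definition _ (H I : lmodType k) :=
  GRing.isLinear.Build k I (H * I)%type _ (@dorroh_inr k H I)
    (@dorroh_inr_linear H I).

Definition dorroh_antipode (H I : lmodType k) (S_H : {linear H -> H})
  (S_I : {linear I -> I}) (p : H * I) : H * I := (S_H p.1, S_I p.2).

Lemma dorroh_antipode_linear (H I : lmodType k) (S_H : {linear H -> H})
  (S_I : {linear I -> I}) : linear (dorroh_antipode S_H S_I).
Proof. by move=> a u v; apply: pair_ext; rewrite /= linearP. Qed.

HB.instance Definition _ (H I : lmodType k) S_H S_I :=
  GRing.isLinear.Build k (H * I)%type (H * I)%type _
    (@dorroh_antipode H I S_H S_I) (dorroh_antipode_linear S_H S_I).

End Linearity.

(** * Multiplication and comultiplication of the Dorroh extension, block by block *)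

Section Dorroh.
Variables (k : fieldType) (H I : lmodType k) (P : dorroh_data H I).
Hypothesis dorrohP : is_dorroh_pair_of_bialgebras P.

Local Notation inl := (@dorroh_inl k H I).
Local Notation inr := (@dorroh_inr k H I).
Local Notation mul := (dorroh_mul P).

Let algP := dpb_algebras dorrohP.
Let coalgP := dpb_coalgebras dorrohP.

Let mulH_bilinear : bilinear_map (mulH P).
Proof. exact: algebra_bilinear (dpa_algebraH algP). Qed.
Let mulI_bilinear : bilinear_map (mulI P).
Proof. exact: algebra_bilinear (dpa_algebraI algP). Qed.
Let lact_bilinear : bilinear_map (lact P).
Proof. exact: bimodule_lbilinear (dpa_bimodule algP). Qed.
Let ract_bilinear : bilinear_map (ract P).
Proof. exact: bimodule_rbilinear (dpa_bimodule algP). Qed.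
Let mul_bilinear : bilinear_map mul.
Proof. exact: algebra_bilinear (bialgebra_algebra (dpb_bialgebra dorrohP)). Qed.

(** One rewrite rule collecting the vanishing of all four products at zero in either argument; it
    removes the cross terms of [mul] on elements lying in a single summand. *)
Let act0E := (fun x => bilinear_map0r x lact_bilinear,
  fun x => bilinear_map0l x lact_bilinear, fun x => bilinear_map0r x ract_bilinear,
  fun x => bilinear_map0l x ract_bilinear, fun x => bilinear_map0r x mulI_bilinear,
  fun x => bilinear_map0l x mulI_bilinear, fun x => bilinear_map0r x mulH_bilinear,
  fun x => bilinear_map0l x mulH_bilinear).

Lemma dorroh_mul_ll a b : mul (inl a) (inl b) = inl (mulH P a b).
Proof.
by rewrite /dorroh_mul /= !act0E !addr0.
Qed.

Lemma dorroh_mul_lr a x : mul (inl a) (inr x) = inr (lact P a x).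
Proof.
by rewrite /dorroh_mul /= !act0E !addr0.
Qed.

Lemma dorroh_mul_rl x a : mul (inr x) (inl a) = inr (ract P x a).
Proof.
by rewrite /dorroh_mul /= !act0E !(addr0, add0r).
Qed.

Lemma dorroh_mul_rr x y : mul (inr x) (inr y) = inr (mulI P x y).
Proof.
by rewrite /dorroh_mul /= !act0E !(addr0, add0r).
Qed.

Lemma comulH0 : comulH P 0 = 0.
Proof. exact: linear_map0 (coalgebra_linear (dpc_coalgebraH coalgP)). Qed.
Lemma comulI0 : comulI P 0 = 0.
Proof. exact: linear_map0 (coalgebra_linear (dpc_coalgebraI coalgP)). Qed.
Lemma lcoact0 : lcoact P 0 = 0.
Proof. exact: linear_map0 (bicomodule_llinear (dpc_bicomodule coalgP)). Qed.
Lemma rcoact0 : rcoact P 0 = 0.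
Proof. exact: linear_map0 (bicomodule_rlinear (dpc_bicomodule coalgP)). Qed.

(** This reduces the counit and antipode axioms to computations on the four blocks of the
    coproduct. *)
Lemma tsum_dorroh_comul (W : lmodType k) (F : H * I -> H * I -> W) p :
  bilinear_map F ->
  tsum (dorroh_comul P p) F
  = \tsum_(h1, h2 <- comulH P p.1) F (inl h1) (inl h2)
    + \tsum_(h, x <- lcoact P p.2) F (inl h) (inr x)
    + \tsum_(x, h <- rcoact P p.2) F (inr x) (inl h)
    + \tsum_(x1, x2 <- comulI P p.2) F (inr x1) (inr x2).
Proof.
move=> FB; rewrite /dorroh_comul !tsumD // !tsum_tsum //.
by congr (_ + _ + _ + _); apply: eq_tsum => u v; rewrite tsum_tens.
Qed.

Let tens_comp_bilinear (U V U' V' : lmodType k) (f : {linear U' -> U})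
  (g : {linear V' -> V}) : bilinear_map (fun u v => f u \ox g v).
Proof. exact: bilinear_map_comp tens_bilinear. Qed.

Lemma dorroh_comul_inl h :
  dorroh_comul P (inl h) = \tsum_(h1, h2 <- comulH P h) inl h1 \ox inl h2.
Proof.
by rewrite /dorroh_comul /= lcoact0 rcoact0 comulI0 !tsum0 // !addr0.
Qed.

Lemma dorroh_comul_inr x :
  dorroh_comul P (inr x)
  = \tsum_(h, y <- lcoact P x) inl h \ox inr y
    + \tsum_(y, h <- rcoact P x) inr y \ox inl h
    + \tsum_(x1, x2 <- comulI P x) inr x1 \ox inr x2.
Proof. by rewrite /dorroh_comul /= comulH0 tsum0 // add0r. Qed.

(** * Convolution of a block-diagonal map with the identity *)

Section Convolution.
Variables (S : {linear (H * I)%type -> (H * I)%type}) (S_H : {linear H -> H})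
  (S_I : {linear I -> I}).
Hypothesis S_inl : forall h, S (inl h) = inl (S_H h).
Hypothesis S_inr : forall x, S (inr x) = inr (S_I x).

(** [S] keeps each block in place, so the multiplication table sends the first block to [H] and the
    other three to [I]. Only the values of [S] on the two summands are prescribed, so that the lemma
    serves both a given antipode and the constructed one. *)
Lemma dorroh_convolution_l p :
  \tsum_(p1, p2 <- dorroh_comul P p) mul (S p1) p2
  = inl (\tsum_(h1, h2 <- comulH P p.1) mulH P (S_H h1) h2)
    + inr (\tsum_(h, y <- lcoact P p.2) lact P (S_H h) y
           + \tsum_(y, h <- rcoact P p.2) ract P (S_I y) h
           + \tsum_(x1, x2 <- comulI P p.2) mulI P (S_I x1) x2).
Proof.
(* [idfun] plays the linear map in the second argument, so that [mul (S p) q] is bilinear as a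
   composite. *)
rewrite tsum_dorroh_comul; last exact: (bilinear_map_comp S idfun).
rewrite !linearD /= !addrA !linear_tsum.
congr (_ + _ + _ + _); apply: eq_tsum => u v; rewrite ?S_inl ?S_inr.
- exact: dorroh_mul_ll.
- exact: dorroh_mul_lr.
- exact: dorroh_mul_rl.
- exact: dorroh_mul_rr.
Qed.

Lemma dorroh_convolution_r p :
  \tsum_(p1, p2 <- dorroh_comul P p) mul p1 (S p2)
  = inl (\tsum_(h1, h2 <- comulH P p.1) mulH P h1 (S_H h2))
    + inr (\tsum_(h, y <- lcoact P p.2) lact P h (S_I y)
           + \tsum_(y, h <- rcoact P p.2) ract P y (S_H h)
           + \tsum_(x1, x2 <- comulI P p.2) mulI P x1 (S_I x2)).
Proof.
rewrite tsum_dorroh_comul; last exact: (bilinear_map_comp idfun S).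
rewrite !linearD /= !addrA !linear_tsum.
congr (_ + _ + _ + _); apply: eq_tsum => u v; rewrite ?S_inl ?S_inr.
- exact: dorroh_mul_ll.
- exact: dorroh_mul_lr.
- exact: dorroh_mul_rl.
- exact: dorroh_mul_rr.
Qed.

End Convolution.

(** * Necessity: from the Hopf extension to [S_I] *)

Variable HH : hopf_algebra (mulH P) (comulH P).

Lemma dorroh_extension_antipode (HA : hopf_algebra (dorroh_mul P) (dorroh_comul P)) :
  is_hopf_dorroh_extension HH HA inl (range inr) ->
  exists S_I : {linear I -> I}, forall x : I,
     \tsum_(h, y <- lcoact P x) lact P (antipode_of HH h) y
     + \tsum_(y, h <- rcoact P x) ract P (S_I y) h
     + \tsum_(x1, x2 <- comulI P x) mulI P (S_I x1) x2 = 0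
     /\
     \tsum_(h, y <- lcoact P x) lact P h (S_I y)
     + \tsum_(y, h <- rcoact P x) ract P y (antipode_of HH h)
     + \tsum_(x1, x2 <- comulI P x) mulI P x1 (S_I x2) = 0.
Proof.
move=> [emb _ ideal _].
(* [S_I] is the [I] component of the antipode restricted to [I]. The ideal is stable under the
   antipode, so the discarded [H] component is zero. *)
pose S_I : {linear I -> I} := snd \o (antipode_of HA \o inr).
have S_inl := hemb_antipode emb.
have S_inr x : antipode_of HA (inr x) = inr (S_I x).
  have [|y _ Sx] := hideal_antipode ideal (x := inr x); first by exists x.
  by rewrite /S_I /= -Sx.
have eps0 x : counit_of HA (inr x) = 0.
  by apply: (hideal_counit ideal); exists x.
exists S_I => x; split.
(* The counit kills [I], so the antipode axiom says that the convolution vanishes at [inr x]; its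
   second component is the required equation. *)
- have := hopf_antipode_l HA (inr x).
  rewrite eps0 scale0r (dorroh_convolution_l S_inl S_inr).
  by move=> /(congr1 snd) /=; rewrite add0r.
- have := hopf_antipode_r HA (inr x).
  rewrite eps0 scale0r (dorroh_convolution_r S_inl S_inr).
  by move=> /(congr1 snd) /=; rewrite add0r.
Qed.

(** * Sufficiency: the Hopf structure built from [S_I] *)

Section Construction.
Variable S_I : {linear I -> I}.
Hypothesis S_I_l : forall x,
  \tsum_(h, y <- lcoact P x) lact P (antipode_of HH h) y
  + \tsum_(y, h <- rcoact P x) ract P (S_I y) h
  + \tsum_(x1, x2 <- comulI P x) mulI P (S_I x1) x2 = 0.
Hypothesis S_I_r : forall x,
  \tsum_(h, y <- lcoact P x) lact P h (S_I y)
  + \tsum_(y, h <- rcoact P x) ract P y (antipode_of HH h)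
  + \tsum_(x1, x2 <- comulI P x) mulI P x1 (S_I x2) = 0.

Let S : {linear (H * I)%type -> (H * I)%type} := dorroh_antipode (antipode_of HH) S_I.
Let eps : {scalar (H * I)%type} := counit_of HH \o fst.

Let S_inl h : S (inl h) = inl (antipode_of HH h).
Proof. by apply: pair_ext => //=; apply: linear0. Qed.
Let S_inr x : S (inr x) = inr (S_I x).
Proof. by apply: pair_ext => //=; apply: linear0. Qed.

(** The first component is the identity law of [H], the second is unitality of the bimodule [I]. *)
Lemma dorroh_one : is_identity mul (inl (one_of HH)).
Proof.
have [one_l one_r] := hopf_one HH.
have unital := bimodule_unital (dpa_bimodule algP) (hopf_one HH).
split=> -[h x]; apply: pair_ext; rewrite /= ?one_l ?one_r //.
  by rewrite (unital x).1 !act0E !addr0.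
by rewrite (unital x).2 !act0E add0r addr0.
Qed.

(** Since [eps] kills [I], two of the four blocks vanish on each side. The other two give the counit
    law of [H] and counitality of the matching coaction. *)
Lemma dorroh_counit : is_counit (dorroh_comul P) eps.
Proof.
have counital := bicomodule_counital (dpc_bicomodule coalgP) (hopf_counit HH).
have eps_l : bilinear_map (fun p q : H * I => eps p *: q).
  split=> [u a v v'|v a u u']; first by rewrite scalerDr !scalerA mulrC.
  by rewrite linearP scalerDl scalerA.
have eps_r : bilinear_map (fun p q : H * I => eps q *: p).
  split=> [u a v v'|v a u u']; last by rewrite scalerDr !scalerA mulrC.
  by rewrite linearP scalerDl scalerA.
have eps_inr x : eps (inr x) = 0 by apply: linear0.
have pairE p : p = inl p.1 + inr p.2 :> H * I.
  by apply: pair_ext; rewrite /= ?addr0 ?add0r.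
move=> p; rewrite !tsum_dorroh_comul //; split.
  rewrite [X in _ + X + _]tsum_eq0 => [|u v]; last by rewrite eps_inr scale0r.
  rewrite [X in _ + X]tsum_eq0 => [|u v]; last by rewrite eps_inr scale0r.
  (* The first occurrences of [p.1] and [p.2] sit under [comulH] and [lcoact]; only the second ones,
     on the right-hand side, are expanded by the counit laws. *)
  rewrite !addr0 [RHS]pairE -{2}(hopf_counit HH p.1).1 -{2}(counital p.2).1.
  by rewrite !linear_tsum; congr (_ + _); apply: eq_tsum => u v; rewrite linearZ.
rewrite [X in _ + X + _ + _]tsum_eq0 => [|u v]; last by rewrite eps_inr scale0r.
rewrite [X in _ + X]tsum_eq0 => [|u v]; last by rewrite eps_inr scale0r.
rewrite !addr0 [RHS]pairE -{2}(hopf_counit HH p.1).2 -{2}(counital p.2).2.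
by rewrite !linear_tsum; congr (_ + _); apply: eq_tsum => u v; rewrite linearZ.
Qed.

Lemma dorroh_comul_one :
  dorroh_comul P (inl (one_of HH)) = inl (one_of HH) \ox inl (one_of HH).
Proof. by rewrite dorroh_comul_inl hopf_comul_one tsum_tens. Qed.

Lemma dorroh_antipode_l p :
  \tsum_(p1, p2 <- dorroh_comul P p) mul (S p1) p2 = eps p *: inl (one_of HH).
Proof.
rewrite (dorroh_convolution_l S_inl S_inr) hopf_antipode_l S_I_l.
by rewrite !linear0 addr0 linearZ.
Qed.

Lemma dorroh_antipode_r p :
  \tsum_(p1, p2 <- dorroh_comul P p) mul p1 (S p2) = eps p *: inl (one_of HH).
Proof.
rewrite (dorroh_convolution_r S_inl S_inr) hopf_antipode_r S_I_r.
by rewrite !linear0 addr0 linearZ.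
Qed.

(** Multiplicativity of the counit is inherited from [H]: [eps] sees only first components, on which
    [mul] is [mulH P]. *)
Definition dorroh_hopf : hopf_algebra (dorroh_mul P) (dorroh_comul P) :=
  @HopfAlgebra k (H * I)%type mul (dorroh_comul P) (inl (one_of HH)) eps S
    (dpb_bialgebra dorrohP) dorroh_one dorroh_counit dorroh_comul_one
    (hopf_counit_one HH) (fun p q => hopf_counit_mul HH p.1 q.1)
    dorroh_antipode_l dorroh_antipode_r.

Lemma dorroh_hopf_extension :
  is_hopf_dorroh_extension HH dorroh_hopf inl (range inr).
Proof.
split; split.
- exact: dorroh_inl_linear.
- by move=> a b [].
- by move=> a b; rewrite dorroh_mul_ll.
- by [].
- exact: dorroh_comul_inl.
- by [].
- exact: S_inl.
- exact: range_is_subspace.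
- by move=> _ _ [a _ <-] [b _ <-]; rewrite dorroh_mul_ll; exists (mulH P a b).
- by exists (one_of HH).
- move=> _ [a _ <-]; rewrite dorroh_comul_inl.
  by apply: tensor_of_sets_tsum => h; exists h.
- by move=> _ [a _ <-]; exists (antipode_of HH a); rewrite // -S_inl.
- exact: range_is_subspace.
(* The product lies in [I] because its first component is a product with the zero first component of
   [inr x]. *)
- move=> [a y] _ [x _ <-]; exists (mul (a, y) (inr x)).2 => //.
  by apply: pair_ext; rewrite //= act0E.
- move=> [a y] _ [x _ <-]; exists (mul (inr x) (a, y)).2 => //.
  by apply: pair_ext; rewrite //= act0E.
(* The two blocks starting in [I] are grouped first, as the part in [I (x) A]; the block in
   [H (x) I] is the part in [A (x) I]. *)
- move=> _ [x _ <-]; rewrite dorroh_comul_inr -addrA addrC.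
  eexists; eexists; split; last reflexivity.
    apply: tensor_of_setsD; apply: tensor_of_sets_tsum => // y; by exists y.
  by apply: tensor_of_sets_tsum => // y; exists y.
- by move=> _ [x _ <-]; apply: linear0.
- by move=> _ [x _ <-]; exists (S_I x); rewrite // -S_inr.
- move=> [h x]; exists (inl h), (inr x); split; [by exists h|by exists x|].
  by apply: pair_ext; rewrite /= ?addr0 ?add0r.
(* Comparing first components in [inr x = inl h] forces [h = 0]. *)
- by move=> _ [h _ <-] [x _ [<-]].
Qed.

End Construction.
End Dorroh.

Theorem proposition1p8 (k : fieldType) (H I : lmodType k) (P : dorroh_data H I)
    (dorrohP : is_dorroh_pair_of_bialgebras P)
    (HH : hopf_algebra (mulH P) (comulH P)) :
  (exists HA : hopf_algebra (dorroh_mul P) (dorroh_comul P),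
     is_hopf_dorroh_extension HH HA (@dorroh_inl k H I) (range (@dorroh_inr k H I)))
  <->
  (exists S_I : {linear I -> I}, forall x : I,
     \tsum_(h, y <- lcoact P x) lact P (antipode_of HH h) y
     + \tsum_(y, h <- rcoact P x) ract P (S_I y) h
     + \tsum_(x1, x2 <- comulI P x) mulI P (S_I x1) x2 = 0
     /\
     \tsum_(h, y <- lcoact P x) lact P h (S_I y)
     + \tsum_(y, h <- rcoact P x) ract P y (antipode_of HH h)
     + \tsum_(x1, x2 <- comulI P x) mulI P x1 (S_I x2) = 0).
Proof.
split=> [[HA]|[S_I S_IP]]; first exact: dorroh_extension_antipode.
exists (dorroh_hopf dorrohP (fun x => (S_IP x).1) (fun x => (S_IP x).2)).
exact: dorroh_hopf_extension.
Qed.
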